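(* The optimal control problem OCP$_i(j)$ (see context), together with feasibility and joint connectivity, does not enforce the relative-interior strictness property $$z_i(j)\notin\bigcap_{k\in\mathcal N_i(j)}\{z_k(j)\}\ \Longrightarrow\ z_i(j+1)\in\operatorname{ri}(\mathcal C_i(j)).$$ More precisely, there exist a finite network of agents, a communication graph and explicit agent states (with data as in the context) such that (i) OCP$_i(j)$ is feasible for all agents $i\in\mathcal V$ and all $j\ge 0$ along the closed loop generated by the distributed MPC routine; in particular $z_i(j+1)\in\mathcal C_i(j)$ and $\|z_i(j+1)-\bar z_i(j)\|\le\alpha(\|z_i(j)-\bar z_i(j)\|)$ with $\alpha<\mathrm{id}$ hold for all $i\in\mathcal V$, $j\ge 0$; (ii) the communication graph satisfies joint spanning-tree connectivity; and such that the following hold: (a) for some time $j$ and some agent $i$, the local hull $\mathcal C_i(j)$ is not a singleton; (b) for these $i$ and $j$, OCP$_i(j)$ admits a feasible solution whose terminal state $x_i(M)$ (which is $z_i(j+1)$ when this solution is implemented) satisfies $z_i(j+1)\in\partial\mathcal C_i(j)$; (c) hence the implication ''$\mathcal C_i(j)$ non-singleton $\Rightarrow z_i(j+1)\in\operatorname{ri}(\mathcal C_i(j))$'' cannot be deduced from OCP$_i(j)$.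
   Context: Setting. There are $\ell\in\mathbb N$ agents, $\mathcal V=\{1,\dots,\ell\}$, with dynamics $x_i(t+1)=g_i(x_i(t),u_i(t))$, $x_i(t)\in\mathcal X_i\subseteq\mathbb R^d$, $u_i(t)\in\mathcal U_i\subseteq\mathbb R^{m_i}$. Each $g_i$ is continuous, locally Lipschitz, and $\mathcal K$-bounded: there are $\kappa_{1,i},\kappa_{2,i}\in\mathcal K_\infty$ with $\|g_i(x,u)\|\le\kappa_{1,i}(\|x\|)+\kappa_{2,i}(\|u\|)$ for all $x\in\mathcal X_i,u\in\mathcal U_i$. (A function is of class $\mathcal K_\infty$ if it is continuous, strictly increasing, zero at zero and unbounded on $[0,\infty)$.) $\|\cdot\|$ is a norm on $\mathbb R^d$. Fix $M\in\mathbb N$ and set $z_i(j)=x_i(jM)$, $j\in\mathbb Z_{\ge0}$. At outer time $j$ the communication structure is a directed graph $\mathcal G(j)=(\mathcal V,\mathcal E(j))$, with $\mathcal N_i(j)=\{k:(k,i)\in\mathcal E(j)\}$. Joint spanning-tree connectivity: there is $B\in\mathbb N$ such that for every $j\in\mathbb Z_{\ge0}$ the union graph $(\mathcal V,\bigcup_{s=j}^{j+B-1}\mathcal E(s))$ contains a directed spanning tree. Local barycenter: $\bar z_i(j)=\frac{1}{1+|\mathcal N_i(j)|}\sum_{k\in\{i\}\cup\mathcal N_i(j)}z_k(j)$. Local hull: $\mathcal C_i(j)=\operatorname{co}(\{z_i(j)\}\cup\{z_k(j):k\in\mathcal N_i(j)\})$. $\operatorname{ri}$ denotes relative interior and $\partial\mathcal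 C_i(j)$ the relative boundary (the boundary within the affine hull). OCP$_i(j)$: given positive definite $Q,R$ and $\alpha\in\mathcal K_\infty$ with $\alpha<\mathrm{id}$ (i.e. $\alpha(s)<s$ for $s>0$), minimize over $u_i(0),\dots,u_i(M-1)$ the cost $$J_i=\sum_{k=0}^{M-1}\big(\|x_i(k)-\bar z_i(j)\|_Q^2+\|u_i(k)-u_i(k-1)\|_R^2\big)$$ subject to $x_i(0)=z_i(j)$; $x_i(k+1)=g_i(x_i(k),u_i(k))$, $x_i(k)\in\mathcal X_i$, $u_i(k)\in\mathcal U_i$ for $k=0,\dots,M-1$; $x_i(M)\in\mathcal X_i\cap\mathcal C_i(j)$; and $\|x_i(M)-\bar z_i(j)\|\le\alpha(\|x_i(0)-\bar z_i(j)\|)$. Here $\|y\|_P^2=y^\top Py$, and $u_i(-1)$ is a given vector (the previously applied input). Standing assumption of the problem: for each $i$ there is an admissible finite-step feedback law $q_i=(q_i^1,\dots,q_i^M):\mathcal X_i\times\bar{\mathcal Z}_i\to\mathcal U_i^M$, where $\bar{\mathcal Z}_i$ is the set of all possible values of $\bar z_i$; admissible means that $g_i(x_i(jM+k-1),q_i^k(x_i(jM),\bar z_i(j)))\in\mathcal X_i$ for all $x_i(jM)\in\mathcal X_i$, $\bar z_i(j)\in\bar{\mathcal Z}_i$, $k=1,\dots,M$; and along the resulting trajectory $\|x_i((j+1)M)-\bar z_i(j)\|\le\alpha(\|x_i(jM)-\bar z_i(j)\|)$ (finite-step Lyapunov decay). Distributed MPC routine: at each outer time $j$ every agent $i$ receives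 $z_k(j)$, $k\in\mathcal N_i(j)$, solves OCP$_i(j)$ to obtain $u_i^\star(0),\dots,u_i^\star(M-1)$, and applies $u_i(t)=u_i^\star(t-jM)$ for $t=jM,\dots,jM+M-1$ in open loop. *)

(* Defs.v *)
(* R^n is 'cV[R]_n with its canonical topology. The norm of the control problem
   is a separate parameter [nrm], a norm on each R^n. *)
From HB Require Import structures.
From mathcomp Require Import all_boot all_order all_algebra.
From mathcomp Require Import all_classical all_reals all_analysis.

Set Implicit Arguments.
Unset Strict Implicit.
Unset Printing Implicit Defensive.

Import Order.TTheory GRing.Theory Num.Theory.
Import numFieldNormedType.Exports.

Local Open Scope classical_set_scope.
Local Open Scope ring_scope.

Section Analysis.
Variable R : realType.

Definition is_norm (V : lmodType R) (N : V -> R) : Prop :=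
  [/\ forall x y, N (x + y) <= N x + N y,
      forall a x, N (a *: x) = `|a| * N x
    & forall x, N x = 0 -> x = 0].

(* The values of [a] on negative reals are irrelevant. *)
Definition class_Kinfty (a : R -> R) : Prop :=
  [/\ {within `[0, +oo[, continuous a},
      {in `[0, +oo[ &, {homo a : s t / s < t}},
      a 0 = 0
    & forall c, exists2 s, 0 <= s & c < a s].

Definition quad n (P : 'M[R]_n) (y : 'cV[R]_n) : R := (y^T *m P *m y) ord0 ord0.

Definition posdef n (P : 'M[R]_n) : Prop :=
  P^T = P /\ forall y : 'cV[R]_n, y != 0 -> 0 < quad P y.

Definition conv_hull n (A : set 'cV[R]_n) : set 'cV[R]_n :=
  smallest (@convex_set R 'cV[R]_n) A.

Definition affine_set n (A : set 'cV[R]_n) : Prop :=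
  forall x y t, A x -> A y -> A (t *: x + (1 - t) *: y).

Definition affine_hull n (A : set 'cV[R]_n) : set 'cV[R]_n :=
  smallest (@affine_set n) A.

(* Interior and boundary of [A] in the subspace topology of its affine hull. *)
Definition rel_interior n (A : set 'cV[R]_n) : set 'cV[R]_n :=
  [set x | affine_hull A x /\ within (affine_hull A) (nbhs x) A].

Definition rel_boundary n (A : set 'cV[R]_n) : set 'cV[R]_n :=
  (affine_hull A `&` closure A) `\` rel_interior A.

Definition is_singleton (T : Type) (A : set T) : Prop := exists p, A = [set p].

End Analysis.

Section Digraphs.
Variable V : finType.

(* [e k i] stands for an edge from k to i. *)
Definition spanning_arborescence (T : rel V) (r : V) : Prop :=
  [/\ forall k, ~~ T k r,
      forall i, i != r -> #|[set k | T k i]%SET| = 1%N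
    & forall i, connect T r i].

Definition has_directed_spanning_tree (e : rel V) : Prop :=
  exists (T : rel V) (r : V), subrel T e /\ spanning_arborescence T r.

Definition union_edges (E : nat -> rel V) (j B : nat) : rel V :=
  fun k i => [exists s : 'I_B, E (j + s)%N k i].

Definition jointly_connected (E : nat -> rel V) : Prop :=
  exists2 B : nat, (0 < B)%N &
    forall j, has_directed_spanning_tree (union_edges E j B).

End Digraphs.

(* [delayed v0 v t] is v(t-1), where v(-1) = v0. *)
Definition delayed (T : Type) (v0 : T) (v : nat -> T) (t : nat) : T :=
  if t is t'.+1 then v t' else v0.

Fixpoint rollout (S T : Type) (f : S -> T -> S) (s : S) (v : nat -> T)
    (k : nat) : S :=
  if k is k'.+1 then f (rollout f s v k') (v k') else s.

Record network (R : realType) := Network {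
  agents : nat;
  sdim : nat;
  idim : 'I_agents -> nat;
  horizon : nat;
  Xset : 'I_agents -> set 'cV[R]_sdim;
  Uset : forall i, set 'cV[R]_(idim i);
  dyn : forall i, 'cV[R]_sdim -> 'cV[R]_(idim i) -> 'cV[R]_sdim;
  edges : nat -> rel 'I_agents;
  Qmx : 'M[R]_sdim;
  Rmx : forall i, 'M[R]_(idim i);
  alpha : R -> R
}.

Arguments idim {R} {n} i : rename.
Arguments Xset {R} {n} i : rename.
Arguments Uset {R} {n} i : rename.
Arguments dyn {R} {n} i : rename.
Arguments Rmx {R} {n} i : rename.
Arguments edges {R} n : rename.

Section Network.
Variables (R : realType) (nrm : forall n, 'cV[R]_n -> R) (S : network R).
Local Notation agent := 'I_(agents S).
Local Notation M := (horizon S).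
Local Notation state := 'cV[R]_(sdim S).

Definition nbrs (j : nat) (i : agent) : {set agent} :=
  [set k | edges S j k i]%SET.

Definition barycenter (j : nat) (z : agent -> state) (i : agent) : state :=
  (1 + #|nbrs j i|)%N%:R^-1 *: \sum_(k in (i |: nbrs j i)%SET) z k.

Definition local_hull (j : nat) (z : agent -> state) (i : agent) : set state :=
  conv_hull ([set z i] `|` [set z k | k in [set k | k \in nbrs j i]]).

(* The values of the local barycenter of i, at any time, compatible with the state constraints. *)
Definition barycenter_values (i : agent) : set state :=
  [set b | exists j (z : agent -> state),
     (forall k, Xset k (z k)) /\ b = barycenter j z i].

(* Continuity and the local Lipschitz property do not depend on the norm. The
   dynamics are taken on the whole of R^d x R^m_i, not just on the constraints. *)
Definition dynamics_ok (i : agent) : Prop :=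
  [/\ continuous (fun p : state * 'cV[R]_(idim i) => dyn i p.1 p.2),
      [locally [lipschitz (fun p : state * 'cV[R]_(idim i) => dyn i p.1 p.2) x
               | x in setT]]
    & exists k1 k2 : R -> R, [/\ class_Kinfty k1, class_Kinfty k2
      & forall x u, Xset i x -> Uset i u ->
          nrm (dyn i x u) <= k1 (nrm x) + k2 (nrm u)]].

(* [q x b k] is the (k+1)-st component of the feedback law at (x, b). *)
Definition feedback_ok (i : agent) : Prop :=
  exists q : state -> state -> nat -> 'cV[R]_(idim i),
    forall x b, Xset i x -> barycenter_values i b ->
    [/\ forall k, (k < M)%N -> Uset i (q x b k),
        forall k, (k < M)%N -> Xset i (rollout (dyn i) x (q x b) k.+1)
      & nrm (rollout (dyn i) x (q x b) M - b) <= alpha S (nrm (x - b))].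

Definition standing_assumptions : Prop :=
  [/\ (0 < agents S)%N, (0 < sdim S)%N, (forall i : agent, (0 < idim i)%N) &
      (0 < M)%N] /\
  [/\ forall j, irreflexive (edges S j),
      posdef (Qmx S), (forall i : agent, posdef (Rmx i)),
      class_Kinfty (alpha S) & forall s, 0 < s -> alpha S s < s] /\
  forall i, dynamics_ok i /\ feedback_ok i.

(* In the optimal control problem of agent i at outer time j, [z] is the vector
   of current agent states and [um] the previously applied input of agent i;
   only the inputs us 0, ..., us (M - 1) play a role. *)
Definition ocp_state (z : agent -> state) i (us : nat -> 'cV[R]_(idim i)) :
    nat -> state :=
  rollout (dyn i) (z i) us.

Definition ocp_cost j z i (um : 'cV[R]_(idim i)) us : R :=
  \sum_(k < M) (quad (Qmx S) (ocp_state z us k - barycenter j z i)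
                + quad (Rmx i) (us k - delayed um us k)).

Definition ocp_feasible j z i (us : nat -> 'cV[R]_(idim i)) : Prop :=
  [/\ forall k, (k < M)%N -> Xset i (ocp_state z us k) /\ Uset i (us k),
      Xset i (ocp_state z us M), local_hull j z i (ocp_state z us M)
    & nrm (ocp_state z us M - barycenter j z i)
      <= alpha S (nrm (ocp_state z us 0 - barycenter j z i))].

Definition ocp_optimal j z i (um : 'cV[R]_(idim i)) us : Prop :=
  ocp_feasible j z us /\
  forall us', ocp_feasible j z us' ->
    ocp_cost j z um us <= ocp_cost j z um us'.

Definition sampled (x : agent -> nat -> state) (j : nat) (i : agent) : state :=
  x i (j * M)%N.

(* [um i] is the input of agent i applied before time 0. *)
Definition mpc_closed_loop (um : forall i : agent, 'cV[R]_(idim i))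
    (x : agent -> nat -> state) (u : forall i : agent, nat -> 'cV[R]_(idim i)) :
    Prop :=
  [/\ forall i, Uset i (um i),
      forall i t, x i t.+1 = dyn i (x i t) (u i t)
    & forall j i, exists us : nat -> 'cV[R]_(idim i),
        ocp_optimal j (sampled x j) (delayed (um i) (u i) (j * M)%N) us /\
        forall k, (k < M)%N -> u i (j * M + k)%N = us k].

End Network.

(* Main.v *)
(* Take M = 1, dynamics x(t+1) = u(t) on the real line without state or input
   constraints, and alpha(s) = s / 2. Three agents start at 0, 1, 1, and agent 0
   hears both others. Its hull is [0, 1] and its barycenter is 2/3; jumping to the
   endpoint 1 shrinks the distance to the barycenter from 2/3 to 1/3, as alpha
   allows. If the previously applied inputs are all 1, this jump costs no input
   variation, so it is optimal, and consensus at 1 is kept from then on. *)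
Require Import Defs.
From HB Require Import structures.
From mathcomp Require Import all_boot all_order all_algebra.
From mathcomp Require Import all_classical all_reals all_analysis.
From mathcomp Require Import lra.
Import Order.TTheory GRing.Theory Num.Theory.
Import numFieldNormedType.Exports.
Local Open Scope classical_set_scope.
Local Open Scope ring_scope.

(** * Norms, comparison functions and quadratic forms *)

Section Norms.
Variables (R : realType) (V : lmodType R) (N : V -> R).
Hypothesis NP : is_norm N.

Lemma is_norm0 : N 0 = 0.
Proof. by have [_ NZ _] := NP; rewrite -(scale0r 0) NZ normr0 mul0r. Qed.

(** Nonnegativity is not among the clauses of [is_norm]; the triangle inequality for x and -x gives
    it. *)
Lemma is_norm_ge0 x : 0 <= N x.
Proof.
have [ND NZ _] := NP; have := ND x (-1 *: x).
by rewrite NZ scaleN1r subrr is_norm0 normrN1; lra.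
Qed.

End Norms.
Arguments is_norm0 {R V N} NP.
Arguments is_norm_ge0 {R V N} NP x.

Lemma class_Kinfty_scale (R : realType) (c : R) :
  0 < c -> class_Kinfty (fun s => c * s).
Proof.
move=> c0; split.
- by apply: continuous_subspaceT => x; exact: mulrl_continuous.
- by move=> s t _ _ st; rewrite ltr_pM2l.
- by rewrite mulr0.
- move=> d; exists (c^-1 * (`|d| + 1)).
    by rewrite mulr_ge0 ?invr_ge0 ?(ltW c0)// addr_ge0.
  by rewrite mulVKf ?gt_eqF//; have := ler_norm d; lra.
Qed.

Lemma quad1E (R : realType) n (y : 'cV[R]_n) :
  quad 1%:M y = \sum_i y i ord0 ^+ 2.
Proof.
by rewrite /quad mulmx1 mxE; apply: eq_bigr => i _; rewrite mxE -expr2.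
Qed.

Lemma quad1_ge0 (R : realType) n (y : 'cV[R]_n) : 0 <= quad 1%:M y.
Proof. by rewrite quad1E sumr_ge0// => i _; rewrite sqr_ge0. Qed.

Lemma posdef1 (R : realType) n : posdef (1%:M : 'M[R]_n).
Proof.
split=> [|y y0]; first exact: trmx1.
rewrite lt_neqAle quad1_ge0 andbT eq_sym quad1E psumr_eq0 => [|i _];
  last exact: sqr_ge0.
apply: contra y0 => /allP y0; apply/eqP/colP => i; rewrite mxE.
by apply/eqP; rewrite -sqrf_eq0; apply: y0; rewrite mem_index_enum.
Qed.

(** * Convex hulls and their relative boundary *)

Lemma sub_conv_hull (R : realType) n (A : set 'cV[R]_n) : A `<=` conv_hull A.
Proof. exact: sub_gen_smallest. Qed.

(** A closed half-space is convex, so it contains the smallest convex set around A. *)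
Lemma conv_hull_le {R : realType} {n} {A : set 'cV[R]_n} {i c} :
  (forall v, A v -> v i ord0 <= c) ->
  forall v, conv_hull A v -> v i ord0 <= c.
Proof.
move=> Ac v Av; apply: (Av [set w | w i ord0 <= c]); split; last exact: Ac.
apply/convex_setW => x y /=; rewrite !inE/= => xc yc l l0 l1.
rewrite inE /= /conv/= !mxE.
have := ler_wpM2l (ltW l0) xc.
have l1_ge0 : 0 <= 1 - l%:num by rewrite subr_ge0 ltW.
have := ler_wpM2l l1_ge0 yc.
by rewrite /unstable.onem; lra.
Qed.

(* Continuing the segment from a to b beyond b stays in the affine hull but leaves
   the half-space in which coordinate i is at most that of b. *)
Lemma conv_hull_rel_boundary {R : realType} {n} {A : set 'cV[R]_n} i a b :
  A a -> A b -> a i ord0 < b i ord0 ->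
  (forall v, A v -> v i ord0 <= b i ord0) ->
  rel_boundary (conv_hull A) b.
Proof.
move=> Aa Ab ab bmax; pose f (t : R) := t *: b + (1 - t) *: a.
have hullA v : A v -> conv_hull A v by exact: sub_conv_hull.
have affA v : A v -> affine_hull (conv_hull A) v.
  by move=> /hullA; exact: sub_gen_smallest.
split; first by split; [exact: affA|apply: subset_closure; exact: hullA].
move=> [_ hull_near_b].
have f1 : f t @[t --> (1 : R)^'+] --> b.
  have -> : b = f 1 by rewrite /f scale1r subrr scale0r addr0.
  apply: cvg_at_right_filter; apply: cvgD; first exact: scalel_continuous.
  by apply: cvgZr_tmp; apply: cvgB; [exact: cvg_cst|exact: cvg_id].
have aff_f t : affine_hull (conv_hull A) (f t).
  by move=> X [affX hullX]; apply: affX; apply: hullX; exact: hullA.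
(* The filter [within] yields hull membership only for points of the affine hull, hence the
   implication, which [aff_f] discharges. *)
have [t [t1 /(_ (aff_f t)) /(conv_hull_le bmax)]] : exists t, 1 < t /\
    (affine_hull (conv_hull A) (f t) -> conv_hull A (f t)).
  near ((1 : R)^'+) => t; exists t; split; first by near: t; exact: nbhs_right_gt.
  by near: t; exact: (f1 _ hull_near_b).
rewrite /f !mxE; nra.
Unshelve. all: by end_near. Qed.

(** This projection is the dynamics of the counterexample. The constant 1 works since the product
    norm is a maximum. *)
Lemma snd_lipschitz (R : realFieldType) (V W : normedModType R) :
  lipschitz (fun p : V * W => p.2).
Proof.
apply: (@klipschitzW _ _ _ 1); first exact: (@globally_properfilter _ _ (0, 0)).
by move=> [x y] _ /=; rewrite mul1r prod_normE le_max lexx orbT.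
Qed.

(** Without self-loops, i and its neighbours form a set of exactly [1 + #|nbrs j i|] agents, so the
    weights add up to 1. *)
Lemma barycenter_cst (R : realType) (S : network R) j
    (z : 'I_(agents S) -> 'cV[R]_(sdim S)) i p :
  irreflexive (edges S j) -> z i = p ->
  (forall k, edges S j k i -> z k = p) -> barycenter j z i = p.
Proof.
move=> irr zi zn; rewrite /barycenter (eq_bigr (fun=> p)) => [|k]; last first.
  by rewrite !inE => /orP[/eqP-> //|/zn].
by rewrite sumr_const cardsU1 inE irr -(scaler_nat _ p) scalerA mulVf
   ?scale1r ?pnatr_eq0.
Qed.

(** * The three-agent counterexample *)

Section Counterexample.
Variables (R : realType) (nrm : forall n, 'cV[R]_n -> R).
Hypothesis nrmP : forall n, is_norm (nrm n).

(** Edges run from larger to smaller indices only, so nobody hears agent 0: agents 1 and 2 see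
    nothing but the value 1. *)
Definition cascade_network : network R := {|
  agents := 3;
  sdim := 1;
  idim := fun=> 1%N;
  horizon := 1;
  Xset := fun=> setT;
  Uset := fun=> setT;
  dyn := fun _ _ u => u;
  edges := fun _ k i => (i < k)%N;
  Qmx := 1%:M;
  Rmx := fun=> 1%:M;
  alpha := fun s => 2^-1 * s |}.

Let one : 'cV[R]_1 := const_mx 1.

Definition cascade_state (i : 'I_3) (t : nat) : 'cV[R]_1 :=
  if (t == 0%N) && (i == ord0) then 0 else one.

Lemma cascade_standing : standing_assumptions nrm cascade_network.
Proof.
split; [by split|split].
  split=> [j k|||| s s0] /=;
    [exact: ltnn|exact: posdef1|by move=> _; exact: posdef1| |].
  - by apply: class_Kinfty_scale; rewrite invr_gt0.
  - by lra.
move=> i; split.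
  split.
  - by move=> p; exact: cvg_snd.
  - exact/lipschitz_locally/snd_lipschitz.
  (* The identity is written [1 * s] to fit [class_Kinfty_scale]. *)
  - exists (fun s => 1 * s), (fun s => 1 * s); split;
      [exact: class_Kinfty_scale|exact: class_Kinfty_scale|].
    by move=> x u _ _ /=; rewrite !mul1r lerDr (is_norm_ge0 (nrmP 1)).
(* The feedback jumps onto the barycenter, leaving distance 0. *)
exists (fun _ b _ => b) => x b _ _; split=> //=.
by rewrite subrr (is_norm0 (nrmP 1)) mulr_ge0 ?(is_norm_ge0 (nrmP 1)).
Qed.

Lemma cascade_connected : jointly_connected (edges cascade_network).
Proof.
(* Both other agents hear agent 2 at every time, so the star rooted there is a spanning tree already
   for B = 1. *)
exists 1%N => // j; exists [rel k i | (k == ord_max) && (i != k)], ord_max; split.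
  move=> k i /= /andP[/eqP-> ik]; apply/existsP; exists ord0 => /=.
  by rewrite ltn_neqAle -ltnS (ltn_ord i) andbT; exact: ik.
split=> [k|i ir|i] /=.
- by rewrite (eq_sym k) andbN.
- rewrite (_ : [set _ | _]%SET = [set ord_max]%SET) ?cards1//.
  by apply/setP => k; rewrite !inE; case: eqP => // ->.
- by have [->|ir] := eqVneq i ord_max; [exact: connect0|apply: connect1].
Qed.

Lemma cascade_barycenter j i :
  barycenter (S := cascade_network) j (cascade_state^~ j) i =
  if (j == 0%N) && (i == ord0) then const_mx (2 / 3) else const_mx 1.
Proof.
case: ifPn => [/andP[/eqP-> /eqP->]|ji].
  apply/colP => o; rewrite /barycenter mxE.
  (* Agent 0 averages over everyone, which gives (0 + 1 + 1) / 3. *)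
  rewrite (_ : nbrs (S := cascade_network) 0 ord0 = [set~ (ord0 : 'I_3)]%SET).
    rewrite finset.setUCr cardsC1 card_ord summxE.
    rewrite (eq_bigl predT) => [|k]; last by rewrite !inE.
    rewrite 3!big_ord_recl big_ord0 /cascade_state /= !mxE.
    by rewrite -[(1 + 2)%N]/3%N; lra.
  by apply/setP => k; rewrite !inE; exact: lt0n.
(* In all other cases the agent and its neighbours are at 1, as agent 0 is never a neighbour. *)
apply: barycenter_cst => [k||k /= ik]; first exact: ltnn.
- by rewrite /cascade_state (negbTE ji).
- by rewrite /cascade_state; case: (k =P ord0) ik => [->//|_]; rewrite andbF.
Qed.

Lemma cascade_local_hull j i :
  local_hull (S := cascade_network) j (cascade_state^~ j) i one.
Proof.
apply: sub_conv_hull; have [->|i0] := eqVneq i ord0; last first.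
  by left; rewrite /= /cascade_state (negbTE i0) andbF.
right; exists ord_max; first by rewrite /= inE.
by rewrite /cascade_state andbF.
Qed.

(** For agent 0 at time 0 both differences are multiples of [one], so homogeneity reduces the claim,
    for any norm, to 1/3 <= 1/2 * 2/3, which is tight. Otherwise the left side vanishes. *)
Lemma cascade_contraction j i :
  nrm 1 (one - barycenter (S := cascade_network) j (cascade_state^~ j) i) <=
  2^-1 * nrm 1 (cascade_state i j -
                barycenter (S := cascade_network) j (cascade_state^~ j) i).
Proof.
have [_ nrmZ _] := nrmP 1.
rewrite cascade_barycenter /cascade_state; case: ifP => _; last first.
  by rewrite subrr (is_norm0 (nrmP 1)) mulr0.
have -> : one - const_mx (2 / 3) = 3^-1 *: one.
  by apply/colP => k; rewrite !mxE; lra.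
have -> : 0 - const_mx (2 / 3) = (- (2 / 3)) *: one.
  by apply/colP => k; rewrite !mxE; lra.
rewrite !nrmZ normrN !ger0_norm ?mulrA; [|lra|lra].
by apply: ler_wpM2r; [exact: is_norm_ge0|lra].
Qed.

Lemma cascade_feasible j i (us : nat -> 'cV[R]_1) : us 0%N = one ->
  ocp_feasible (S := cascade_network) nrm j (cascade_state^~ j) (i := i) us.
Proof.
move=> us0; split=> //; rewrite /ocp_state /= us0.
- exact: cascade_local_hull.
- exact: cascade_contraction.
Qed.

(** With horizon 1 the tracking term is evaluated only at the initial state, so all inputs share it;
    what remains is the input variation, here zero. *)
Lemma cascade_optimal j i :
  ocp_optimal (S := cascade_network) nrm j (cascade_state^~ j) (i := i) one (fun=> one).
Proof.
split=> [|us _]; first exact: cascade_feasible.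
rewrite /ocp_cost !big_ord1 /ocp_state /= lerD2l subrr.
by rewrite quad1E big1 ?quad1_ge0// => k _; rewrite mxE expr0n.
Qed.

Lemma sampled_cascade :
  sampled (S := cascade_network) cascade_state = fun j i => cascade_state i j.
Proof. by apply/funext => j; apply/funext => i; rewrite /sampled muln1. Qed.

Lemma cascade_closed_loop :
  mpc_closed_loop (S := cascade_network) nrm (fun=> one) cascade_state (fun _ _ => one).
Proof.
split=> // j i; exists (fun=> one); split=> //.
(* The previous input is [one] both at time 0, by the choice of [um], and later. *)
rewrite sampled_cascade (_ : delayed _ _ _ = one); last by case: (_ * _)%N.
exact: cascade_optimal.
Qed.

Lemma cascade_rel_boundary :
  rel_boundary (local_hull (S := cascade_network) 0 (cascade_state^~ 0%N) ord0) one.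
Proof.
apply: (conv_hull_rel_boundary ord0 0).
- by left.
- right; exists ord_max; first by rewrite /= inE.
  by rewrite /cascade_state andbF.
- by rewrite !mxE.
- by move=> v [->|[k _ <-]]; rewrite /cascade_state; case: (_ && _); rewrite !mxE.
Qed.

Lemma cascade_not_singleton :
  ~ is_singleton (local_hull (S := cascade_network) 0 (cascade_state^~ 0%N) ord0).
Proof.
move=> [p hullE]; have := cascade_local_hull 0 ord0; rewrite hullE /= => oneE.
have : local_hull (S := cascade_network) 0 (cascade_state^~ 0%N) ord0 0.
  by apply: sub_conv_hull; left.
rewrite hullE /= -oneE => /colP/(_ ord0); rewrite !mxE => /eqP.
by rewrite eq_sym oner_eq0.
Qed.

End Counterexample.

Theorem proposition2 (R : realType) (nrm : forall n, 'cV[R]_n -> R)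
    (nrmP : forall n, is_norm (nrm n)) :
  exists (S : network R)
         (um : forall i : 'I_(agents S), 'cV[R]_(idim i))
         (x : 'I_(agents S) -> nat -> 'cV[R]_(sdim S))
         (u : forall i : 'I_(agents S), nat -> 'cV[R]_(idim i)),
  let z := sampled x in
  [/\ standing_assumptions nrm S,
      mpc_closed_loop nrm um x u,
      (forall i j,
        [/\ exists us : nat -> 'cV[R]_(idim i), ocp_feasible nrm j (z j) us,
            local_hull j (z j) i (z j.+1 i)
          & nrm _ (z j.+1 i - barycenter j (z j) i)
            <= alpha S (nrm _ (z j i - barycenter j (z j) i))]),
      jointly_connected (edges S)
    & exists (j : nat) (i : 'I_(agents S)),
      [/\ ~ is_singleton (local_hull j (z j) i),
          exists us : nat -> 'cV[R]_(idim i),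
            ocp_feasible nrm j (z j) us /\
            rel_boundary (local_hull j (z j) i)
              (ocp_state (z j) us (horizon S)),
          ~ (forall us : nat -> 'cV[R]_(idim i),
               ocp_feasible nrm j (z j) us ->
               ~ is_singleton (local_hull j (z j) i) ->
               rel_interior (local_hull j (z j) i)
                 (ocp_state (z j) us (horizon S)))
        & ~ (forall us : nat -> 'cV[R]_(idim i),
               ocp_feasible nrm j (z j) us ->
               ~ (\bigcap_(k in [set k | k \in nbrs j i]) [set z j k]) (z j i) ->
               rel_interior (local_hull j (z j) i)
                 (ocp_state (z j) us (horizon S)))]].
Proof.
exists (cascade_network R), (fun=> const_mx 1), (cascade_state R),
  (fun _ _ => const_mx 1).
rewrite /= sampled_cascade; split.
- exact: cascade_standing.
- exact: cascade_closed_loop.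
- move=> i j; split.
  + by exists (fun=> const_mx 1); exact: cascade_feasible.
  + exact: cascade_local_hull.
  + exact: cascade_contraction.
- exact: cascade_connected.
- have feas := cascade_feasible R nrm nrmP 0 ord0 (fun=> const_mx 1) erefl.
  have [_ not_ri] := cascade_rel_boundary R.
  exists 0%N, ord0; split.
  + exact: cascade_not_singleton.
  + by exists (fun=> const_mx 1); split; [exact: feas|exact: cascade_rel_boundary].
  + by move=> /(_ _ feas (cascade_not_singleton R)).
  (* Agent 2 is a neighbour of agent 0 with state 1, so the state 0 is not in the intersection. *)
  + move=> /(_ _ feas) ri; apply/not_ri/ri => /(_ ord_max).
    rewrite /= inE => /(_ isT); rewrite /cascade_state /= => /colP/(_ ord0).
    by rewrite !mxE => /eqP; rewrite eq_sym oner_eq0.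
Qed.
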